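(* Let $n\ge1$ be an integer and $\beta$ a complex number, and define the polynomial $P_n(x)$ by $$\frac{P_n(x)}{(1-x)^{n+1}}=\sum_{m\ge0}\frac{m}{m+n\beta}\binom{m+n\beta}{n}x^m .$$ Then $$P_n(x)=\frac1n\sum_{m=1}^{n}\binom{n(1-\beta)}{m-1}\binom{n\beta}{n-m}x^m .$$
   Context: $\binom{c}{k}=c(c-1)\cdots(c-k+1)/k!$ for complex $c$ and integers $k\ge0$. The coefficient $\frac{m}{m+n\beta}\binom{m+n\beta}{n}$ is understood as the polynomial expression $\frac{m}{n}\binom{m+n\beta-1}{n-1}$ in $m$ (so no division by zero occurs). Here $\sum_m \frac{m}{m+n\beta}\binom{m+n\beta}{n}x^m$ is the $n$th descending diagonal of the Riordan array $(1,x\,{}_{(\beta)}a(x))$, where ${}_{(\beta)}a(x)$ is the generalized binomial series $\sum_{k\ge0}\frac{1}{1+k\beta}\binom{1+k\beta}{k}x^k$. *)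

(* Defs.v *)
From mathcomp Require Export all_boot all_order all_algebra.
From mathcomp Require Export reals.
From mathcomp.real_closed Require Export complex.

Set Implicit Arguments.
Unset Strict Implicit.
Unset Printing Implicit Defensive.

Import Order.TTheory GRing.Theory Num.Theory.
Local Open Scope ring_scope.

Definition gbinom (K : fieldType) (c : K) (k : nat) : K :=
  (\prod_(i < k) (c - i%:R)) / (k`!)%:R.

(* [diag_coef n beta m] is the coefficient m/(m + n beta) binom(m + n beta, n),
   in its division-free reading as a polynomial in m; the two agree whenever
   m + n beta <> 0, see [diag_coefE]. *)
Definition diag_coef (K : fieldType) (n : nat) (beta : K) (m : nat) : K :=
  m%:R / n%:R * gbinom (m%:R + n%:R * beta - 1) n.-1.

(* A formal power series is represented by its sequence of coefficients. *)
Definition fps (K : fieldType) : Type := nat -> K.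

Definition fps_poly (K : fieldType) (p : {poly K}) : fps K := fun k => p`_k.

Definition fps_mul (K : fieldType) (f g : fps K) : fps K :=
  fun k => \sum_(i < k.+1) f i * g (k - i)%N.

(* The first k coefficients of 1 / f, obtained by solving (1 / f) * f = 1
   degree by degree; meaningful when f 0 <> 0, see [fps_mulVf]. *)
Fixpoint fps_inv_coefs (K : fieldType) (f : fps K) (k : nat) : seq K :=
  if k is j.+1 then
    let s := fps_inv_coefs f j in
    rcons s (((j == 0%N)%:R - \sum_(i < j) s`_i * f (j - i)%N) / f 0%N)
  else [::].

Definition fps_inv (K : fieldType) (f : fps K) : fps K :=
  fun k => (fps_inv_coefs f k.+1)`_k.

Definition fps_div (K : fieldType) (f g : fps K) : fps K :=
  fps_mul f (fps_inv g).

Lemma gbinomS (K : fieldType) (c : K) (k : nat) :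
  gbinom c k.+1 = c / k.+1%:R * gbinom (c - 1) k.
Proof.
rewrite /gbinom big_ord_recl subr0 factS natrM invfM.
under eq_bigr => i _ do rewrite lift0 -natr1 [_ + 1]addrC opprD addrA.
by rewrite !mulrA; congr (_ * _); rewrite mulrAC.
Qed.

Lemma diag_coefE (K : fieldType) (n : nat) (beta : K) (m : nat) :
  (0 < n)%N -> m%:R + n%:R * beta != 0 ->
  diag_coef n beta m =
    m%:R / (m%:R + n%:R * beta) * gbinom (m%:R + n%:R * beta) n.
Proof.
case: n => // n _ nz; rewrite gbinomS /diag_coef /= !mulrA; congr (_ * _ * _).
by rewrite divfK.
Qed.

Lemma size_fps_inv_coefs (K : fieldType) (f : fps K) (k : nat) :
  size (fps_inv_coefs f k) = k.
Proof. by elim: k => //= k IHk; rewrite size_rcons IHk. Qed.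

Lemma nth_fps_inv_coefs (K : fieldType) (f : fps K) (k i : nat) :
  (i < k)%N -> (fps_inv_coefs f k)`_i = fps_inv f i.
Proof.
elim: k => // k IHk; rewrite ltnS leq_eqVlt => /predU1P[-> // | lt_ik].
by rewrite /= nth_rcons size_fps_inv_coefs lt_ik IHk.
Qed.

Lemma fps_mulVf (K : fieldType) (f : fps K) : f 0%N != 0 ->
  fps_mul (fps_inv f) f =1 fps_poly 1.
Proof.
move=> nz k; rewrite /fps_mul big_ord_recr /= subnn.
rewrite {2}/fps_inv /= nth_rcons size_fps_inv_coefs ltnn eqxx divfK //.
rewrite [X in _ + (_ - X)](eq_bigr (fun i : 'I_k => fps_inv f i * f (k - i)%N)).
  by rewrite addrC subrK /fps_poly coef1.
by move=> i _; rewrite nth_fps_inv_coefs.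
Qed.

(* Main.v *)
(** Expanding [1/(1-x)^(n+1)] reduces the theorem to the convolution identity
    [\sum_i C(r, i) C(n-r, n-1-i) C(k+i, n) = k C(k+r-1, n-1)] with
    [r = n beta], an instance of Nanjundiah's identity.  The latter follows from
    three Vandermonde summations: expand [C(x+i, m+n)] in the basis [C(i, s)],
    sum over [i] after trinomial revision, revise again, and sum over [s]. *)
Require Import Defs.
From mathcomp Require Import ring zify.

Set Implicit Arguments.
Unset Strict Implicit.
Unset Printing Implicit Defensive.

Import Order.TTheory GRing.Theory Num.Theory.
Local Open Scope ring_scope.

Section GeneralizedBinomial.
Variable K : numFieldType.
Implicit Types (a b c x : K) (k m n s t : nat).

Lemma gbinom0 c : gbinom c 0 = 1.
Proof. by rewrite /gbinom big_ord0 fact0 divr1. Qed.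

(** Division-free form behind the inductions on the lower index below: multiply by the successor,
    nonzero in characteristic zero, then apply it. *)
Lemma gbinom_recr c k :
  k.+1%:R * gbinom c k.+1 = (c - k%:R) * gbinom c k.
Proof.
rewrite /gbinom big_ord_recr factS natrM /=.
have h1 : k.+1%:R != 0 :> K by rewrite pnatr_eq0.
have h2 : k`!%:R != 0 :> K by rewrite pnatr_eq0 -lt0n fact_gt0.
move: (\prod_(i < k) _) (k`!%:R) h2 => u v h2.
by field; rewrite h2 addrC natr1.
Qed.

Lemma gbinom_nat m k : gbinom (m%:R : K) k = 'C(m, k)%:R.
Proof.
elim: k => [|k IHk]; first by rewrite gbinom0 bin0.
apply: (@mulfI _ k.+1%:R); first by rewrite pnatr_eq0.
rewrite gbinom_recr IHk -natrM mul_bin_left natrM.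
have [lekm|ltmk] := leqP k m; first by rewrite natrB.
by rewrite bin_small // !mulr0.
Qed.

Lemma gbinom_opp n k :
  gbinom (- n.+1%:R : K) k = (-1) ^+ k * 'C(n + k, n)%:R.
Proof.
elim: k => [|k IHk]; first by rewrite gbinom0 addn0 binn mulr1.
apply: (@mulfI _ k.+1%:R); first by rewrite pnatr_eq0.
rewrite gbinom_recr IHk [RHS]mulrCA -natrM.
have -> : (k.+1 * 'C(n + k.+1, n) = (n.+1 + k) * 'C(n + k, n))%N.
  rewrite -(bin_sub (leq_addr k.+1 n)) -(bin_sub (leq_addr k n)) !addKn.
  by rewrite addnS -mul_bin_diag.
by rewrite natrM natrD exprS; ring.
Qed.

Lemma gbinomD a b n :
  gbinom (a + b) n = \sum_(i < n.+1) gbinom a i * gbinom b (n - i).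
Proof.
elim: n => [|n IHn]; first by rewrite big_ord1 !gbinom0 mulr1.
apply: (@mulfI _ n.+1%:R); first by rewrite pnatr_eq0.
pose F i := gbinom a i * gbinom b (n.+1 - i).
(* Split [n.+1] as [i + (n.+1 - i)]: each part is absorbed by one factor of [F i], and dropping the
   zero terms at [i = 0] and [i = n.+1] realigns the two sums. *)
have -> : n.+1%:R * \sum_(i < n.+2) F i
    = \sum_(i < n.+2) i%:R * F i + \sum_(i < n.+2) (n.+1 - i)%:R * F i.
  rewrite mulr_sumr -big_split /=; apply: eq_bigr => i _.
  by rewrite -mulrDl -natrD subnKC // -ltnS.
rewrite big_ord_recl mul0r add0r [X in _ = _ + X]big_ord_recr /=.
rewrite subnn mul0r addr0 -big_split gbinom_recr IHn mulr_sumr /=.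
apply: eq_bigr => i _; have lein : (i <= n)%N by rewrite -ltnS.
rewrite /F /bump leq0n add1n subSS subSn //.
rewrite [i.+1%:R * _]mulrA gbinom_recr [_ * (gbinom a i * _)]mulrCA gbinom_recr.
by rewrite natrB //; ring.
Qed.

(** Trinomial revision: from [t] to [t.+1], after multiplication by [t.+1], both sides gain the
    factor [a - s - t]. *)
Lemma gbinom_trinomial a s t :
  gbinom a (s + t) * 'C(s + t, s)%:R = gbinom a s * gbinom (a - s%:R) t.
Proof.
elim: t => [|t IHt]; first by rewrite addn0 binn gbinom0.
apply: (@mulfI _ t.+1%:R); first by rewrite pnatr_eq0.
rewrite [RHS]mulrCA gbinom_recr [RHS]mulrCA -IHt addnS.
have := mul_bin_down (s + t).+1 s; rewrite subSn ?leq_addr // addKn /= => e.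
rewrite mulrCA -natrM -e natrM mulrCA mulrA gbinom_recr natrD; ring.
Qed.

(** Only [i >= s] contributes; trinomial revision extracts [gbinom a s] and leaves a Vandermonde sum
    with upper arguments [a - s] and [b]. *)
Lemma gbinom_sum_bin a b s n : (s <= n)%N ->
  \sum_(i < n.+1) 'C(i, s)%:R * (gbinom a i * gbinom b (n - i))
  = gbinom a s * gbinom (a + b - s%:R) (n - s).
Proof.
move=> lesn; pose F i := 'C(i, s)%:R * (gbinom a i * gbinom b (n - i)).
rewrite -(big_mkord xpredT F) (@big_cat_nat _ _ _ s) ?(leqW lesn) //=.
rewrite big_nat_cond big1 => [|i /andP[/andP[_ ltis] _]]; last first.
  by rewrite /F bin_small // mul0r.
rewrite add0r -{1}[s]add0n big_addn subSn // big_mkord.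
rewrite addrAC gbinomD mulr_sumr; apply: eq_bigr => t _.
rewrite /F mulrA mulrA -gbinom_trinomial [(t + s)%N]addnC subnDA.
by rewrite [_ * gbinom a _]mulrC.
Qed.

Lemma gbinom_nanjundiah a x m n :
  \sum_(i < n.+1) gbinom a i * gbinom ((m + n)%:R - a) (n - i)
      * gbinom (x + i%:R) (m + n)
  = gbinom x m * gbinom (x - m%:R + a) n.
Proof.
pose b := (m + n)%:R - a.
transitivity (\sum_(i < n.+1) \sum_(s < n.+1) gbinom x (m + n - s) *
     ('C(i, s)%:R * (gbinom a i * gbinom b (n - i)))).
  apply: eq_bigr => i _; rewrite [x + _]addrC (gbinomD i%:R) mulr_sumr.
  pose G s := gbinom x (m + n - s) *
     ('C(i, s)%:R * (gbinom a i * gbinom b (n - i))).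
  (* Vandermonde sums up to [m + n], but ['C(i, s)] vanishes for [s > n >= i]; the shorter range
     lets one bound serve both sums. *)
  rewrite (@big_ord_widen _ _ _ n.+1 (m + n).+1 G) ?ltnS ?leq_addl //.
  rewrite [RHS]big_mkcond; apply: eq_bigr => s _; rewrite gbinom_nat /G /b.
  case: ifP => [_|/negbT]; first by ring.
  rewrite -leqNgt => ltns.
  by rewrite bin_small ?(leq_trans (ltn_ord i)) // mul0r mulr0.
rewrite exchange_big [x - _ + a]addrC gbinomD mulr_sumr; apply: eq_bigr => s _ /=.
have lesn : (s <= n)%N by rewrite -ltnS.
(* As [a + b] is the natural number [m + n], an ordinary ['C(m + n - s, n - s)] remains, and its
   symmetry permits the second revision, now in [x]. *)
rewrite -mulr_sumr gbinom_sum_bin // addrCA subrr addr0.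
rewrite -natrB ?(leq_trans lesn) ?leq_addl // gbinom_nat -addnBA //.
rewrite mulrCA [RHS]mulrCA -gbinom_trinomial.
by rewrite -(bin_sub (leq_addr (n - s) m)) addKn.
Qed.

End GeneralizedBinomial.

Section PowerSeries.
Variable K : fieldType.
Implicit Types f g h : fps K.

(** Once the lower coefficients agree, the convolutions differ only in their last term, which
    carries the factor [h 0]. *)
Lemma fps_mulIf h f g : h 0%N != 0 -> fps_mul f h =1 fps_mul g h -> f =1 g.
Proof.
move=> h0 e k; elim/ltn_ind: k => k IHk.
have := e k; rewrite /fps_mul !big_ord_recr /= subnn.
rewrite (eq_bigr (fun i : 'I_k => g i * h (k - i)%N)) => [|i _].
  by move/addrI/(mulIf h0).
by rewrite IHk.
Qed.

End PowerSeries.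

Section NegativePower.
Variable K : numFieldType.

Lemma coef_exp1subX n k :
  ((1 - 'X : {poly K}) ^+ n)`_k = (-1) ^+ k * 'C(n, k)%:R.
Proof.
elim: n k => [|n IHn] [|k]; rewrite ?expr0 ?coef1 ?bin0n ?mulr1 ?mulr0 //.
  by rewrite exprS mulrBl mul1r coefB coefXM subr0 IHn bin0 mulr1.
rewrite exprS mulrBl mul1r coefB coefXM /= !IHn binS natrD exprS.
by ring.
Qed.

(** Up to sign, the product of the claimed series with the power of [1 - x] is Vandermonde for
    [-(n + 1)] and [n + 1], whose sum is zero. *)
Lemma fps_inv_exp1subX n k :
  fps_inv (fps_poly ((1 - 'X : {poly K}) ^+ n.+1)) k = 'C(n + k, n)%:R.
Proof.
set D := fps_poly _.
have D0 : D 0%N != 0 by rewrite /D /fps_poly coef_exp1subX bin0 mulr1 oner_eq0.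
apply: (@fps_mulIf _ D _ (fun k => 'C(n + k, n)%:R)) => // {}k.
rewrite fps_mulVf // /fps_poly coef1 /fps_mul.
transitivity ((-1) ^+ k * gbinom (- n.+1%:R + n.+1%:R : K) k).
  by rewrite addNr (gbinom_nat K 0) bin0n; case: k => [|k]; rewrite ?mulr0 ?mulr1.
rewrite gbinomD mulr_sumr; apply: eq_bigr => i _.
rewrite gbinom_opp gbinom_nat /D /fps_poly coef_exp1subX.
have lei : (i <= k)%N by rewrite -ltnS.
rewrite -{1}(subnKC lei) exprD.
have e j : (-1) ^+ j * (-1) ^+ j = 1 :> K by rewrite -exprMn mulrNN mulr1 expr1n.
rewrite -[RHS]mul1r -[X in _ = X * _](e i); ring.
Qed.

Definition diag_numer n (beta : K) : {poly K} :=
  n%:R^-1 *: \sum_(1 <= m < n.+1)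
    (gbinom (n%:R * (1 - beta)) m.-1 * gbinom (n%:R * beta) (n - m)) *: 'X^m.

Lemma coef_diag_numer n (beta : K) m :
  (diag_numer n beta)`_m =
  if (0 < m <= n)%N then n%:R^-1 *
    (gbinom (n%:R * (1 - beta)) m.-1 * gbinom (n%:R * beta) (n - m))
  else 0.
Proof.
rewrite coefZ coef_sum.
under eq_bigr => i _ do rewrite coefZ coefXn.
case: ifP => [hm|hm]; last first.
  rewrite big_nat big1 ?mulr0 // => i hi.
  by case: eqP => [em|_]; [rewrite em hi in hm|rewrite !mulr0].
rewrite (bigD1_seq m) ?iota_uniq ?mem_index_iota ?ltnS //= eqxx mulr1.
by rewrite big1 ?addr0 // => i /negbTE; rewrite eq_sym => ->; rewrite mulr0.
Qed.

Lemma fps_div_diag_numer n (beta : K) : (0 < n)%N ->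
  fps_div (fps_poly (diag_numer n beta)) (fps_poly ((1 - 'X) ^+ n.+1))
  =1 diag_coef n beta.
Proof.
case: n => // n _ k; rewrite /fps_div /fps_mul.
pose G m : K := (diag_numer n.+1 beta)`_m * 'C(n.+1 + k - m, n.+1)%:R.
transitivity (\sum_(m < n.+2) G m).
  transitivity (\sum_(m < k.+1) G m).
    apply: eq_bigr => i _; rewrite fps_inv_exp1subX /G addnBA //.
    by rewrite -ltnS.
  (* Both ranges extend to a common one: the numerator has degree at most [n.+1], and for
     [k < m <= n.+1] the binomial in [G m] has its top below [n.+1]. *)
  pose M := (k.+1 + n.+2)%N.
  rewrite (@big_ord_widen _ _ _ k.+1 M) ?leq_addr //.
  rewrite (@big_ord_widen _ _ _ n.+2 M) ?leq_addl //.
  rewrite big_mkcond [RHS]big_mkcond; apply: eq_bigr => i _.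
  rewrite /G coef_diag_numer !ltnS.
  case: (leqP i k) => hk; case: (leqP i n.+1) => hn //=.
  - by rewrite andbF mul0r.
  - by rewrite bin_small ?mulr0 //; lia.
rewrite big_ord_recl /G coef_diag_numer /= mul0r add0r.
(* Putting [m = n.+1 - i] gives the left side of [gbinom_nanjundiah] at [m := 1], [x := k],
   [a := n.+1 * beta]. *)
rewrite (reindex_inj rev_ord_inj) /= /diag_coef mulrAC.
transitivity (n.+1%:R^-1 * \sum_(i < n.+1) gbinom (n.+1%:R * beta) i *
   gbinom ((1 + n)%:R - n.+1%:R * beta) (n - i) * gbinom (k%:R + i%:R : K) (1 + n)).
  rewrite mulr_sumr; apply: eq_bigr => i _.
  have lei : (i <= n)%N by rewrite -ltnS.
  rewrite /bump leq0n add1n subSS coef_diag_numer subSS.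
  rewrite ltn0Sn ltnS leq_subr /= subKn //.
  have -> : (n.+1 + k - (n - i).+1 = k + i)%N by lia.
  by rewrite mulrBr mulr1 -natrD gbinom_nat; ring.
rewrite gbinom_nanjundiah gbinom_nat bin1 [LHS]mulrC.
by congr (_ * gbinom _ _ / _); ring.
Qed.

End NegativePower.

Theorem theorem5 (R : realType) (n : nat) (beta : R[i]) (P : {poly R[i]}) :
  (0 < n)%N ->
  fps_div (fps_poly P) (fps_poly ((1 - 'X) ^+ n.+1)) =1 diag_coef n beta
  <->
  P = n%:R^-1 *: \sum_(1 <= m < n.+1)
        (gbinom (n%:R * (1 - beta)) m.-1 * gbinom (n%:R * beta) (n - m)) *: 'X^m.
Proof.
move=> n_gt0; rewrite -[X in P = X]/(diag_numer n beta).
split=> [eP|->]; last exact: fps_div_diag_numer.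
(* Uniqueness: the inverse series has constant term 1, so it can be cancelled. *)
apply/polyP; apply: (@fps_mulIf _ (fps_inv (fps_poly ((1 - 'X) ^+ n.+1)))).
  by rewrite fps_inv_exp1subX addn0 binn oner_eq0.
by move=> k; rewrite [LHS]eP -fps_div_diag_numer.
Qed.
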